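(* For all $n\geq 2$, in terms of Pell-Lucas numbers $Q_k$: $$B_{n}^{neobc}=\frac{36Q_{4n-4}+15Q_{4n-5}+6}{8},\quad C_{n}^{neobc}=\frac{51Q_{4n-4}+21Q_{4n-5}}{4},$$ $$R_{n}^{neobc}=\frac{15Q_{4n-4}+6Q_{4n-5}-10}{8},\quad CR_{n}^{neobc}=\frac{21Q_{4n-4}+9Q_{4n-5}}{8}.$$
   Context: Pell-Lucas numbers: $Q_0=Q_1=2$, $Q_k=2Q_{k-1}+Q_{k-2}$. A positive integer $m$ is a neo balcobalancing number if there is a positive integer $r$ (its neo balcobalancer) such that $(1+2+\cdots+(m-1))+(1+2+\cdots+m)=2[(m-1)+m+(m+1)+(m+2)+\cdots+(m+r)]$; then $r=\frac{-2m-1+\sqrt{8m^2-12m+9}}{2}$ (equivalently, $m$ is a neo balcobalancing number iff $8m^2-12m+9$ is a perfect square). $B_n^{neobc}$ denotes the $n$-th neo balcobalancing number in increasing order ($n\ge1$), $R_n^{neobc}$ its neo balcobalancer, $C_n^{neobc}=\sqrt{8(B_n^{neobc})^2-12B_n^{neobc}+9}$ and $CR_n^{neobc}=\sqrt{2(R_n^{neobc})^2+5R_n^{neobc}+2}$. *)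

(* Defs.v *)
From mathcomp Require Import all_boot all_order all_algebra.
From mathcomp Require Import boolp classical_sets reals.

Set Implicit Arguments.
Unset Strict Implicit.
Unset Printing Implicit Defensive.

Import GRing.Theory Num.Theory.

Local Open Scope nat_scope.

Fixpoint pell_lucas (k : nat) : nat :=
  match k with
  | 0 => 2
  | k'.+1 => match k' with
             | 0 => 2
             | k''.+1 => 2 * pell_lucas k' + pell_lucas k''
             end
  end.

(* The truncated predecessor m.-1 is the true m - 1 because m is positive. *)
Definition neo_balcobalancer (m r : nat) : Prop :=
  [/\ 0 < m, 0 < r &
      \sum_(1 <= i < m) i + \sum_(1 <= i < m.+1) i
      = 2 * \sum_(m.-1 <= i < (m + r).+1) i].

Definition neo_balcobalancing (m : nat) : Prop :=
  exists r, neo_balcobalancer m r.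

(* m is the n-th neo balcobalancing number, counting from n = 1: exactly n of
   them lie in {1, ..., m}, m included. *)
Definition nth_neo_balcobalancing (n m : nat) : Prop :=
  neo_balcobalancing m /\
  count (fun k => `[< neo_balcobalancing k >]) (iota 1 m) = n.

(* In Bneobc and Rneobc the default value 0 marks non-existence: neither a neo
   balcobalancing number nor a balancer can be 0. *)
Definition Bneobc (n : nat) : nat :=
  xget 0 [set m | nth_neo_balcobalancing n m]%classic.

Definition Rneobc (n : nat) : nat :=
  xget 0 [set r | neo_balcobalancer (Bneobc n) r]%classic.

Local Open Scope ring_scope.

Definition Cneobc (R : realType) (n : nat) : R :=
  Num.sqrt (8 * (Bneobc n)%:R ^+ 2 - 12 * (Bneobc n)%:R + 9).

Definition CRneobc (R : realType) (n : nat) : R :=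
  Num.sqrt (2 * (Rneobc n)%:R ^+ 2 + 5 * (Rneobc n)%:R + 2).

(* Main.v *)
Require Import Defs.
From mathcomp Require Import all_boot all_order all_algebra.
From mathcomp Require Import boolp classical_sets reals.
From mathcomp Require Import zify lra.

Import GRing.Theory Num.Theory.
Local Open Scope ring_scope.

(** The defining equation of a neo balcobalancer is [m^2 = (r+2)(2m+r-1)], that
    is [(4m-3)^2 - 2(2m+2r+1)^2 = -9]. The automorphism of this Pell form given
    by the unit [17 + 12 sqrt 2] acts on solutions by
    [(m, r) |-> (29m+12r-6, 12m+5r-4)], and descending along its inverse shows
    that every positive solution lies on the orbit of [(6, 1)]. This orbit
    increases, so it enumerates the neo balcobalancing numbers, and its closed
    form in Pell-Lucas numbers follows by induction. On solutions
    [8m^2-12m+9 = (2m+2r+1)^2] and [2r^2+5r+2 = (m-r-2)^2]. *)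

Lemma sum_nat_interval (a k : nat) :
  (2 * \sum_(a <= i < a + k) i + k = k * (2 * a + k))%N.
Proof.
elim: k => [|k IH]; first by rewrite (addn0 a) big_geq.
by rewrite (addnS a) big_nat_recr ?leq_addr //=; nia.
Qed.

(* Both sides of [m^2 = (r+2)(2m+r-1)] are increased by [r+2] to avoid the
   truncated subtraction. *)
Lemma neo_balcobalancerE (m r : nat) :
  neo_balcobalancer m r <->
  [/\ (0 < m)%N, (0 < r)%N & (m * m + r + 2 = (r + 2) * (2 * m + r))%N].
Proof.
case: m => [|m]; first by split; case.
have S1 := sum_nat_interval 1 m; have S2 := sum_nat_interval 1 m.+1.
have S3 := sum_nat_interval m r.+2.
rewrite /neo_balcobalancer /= (_ : (m.+1 + r).+1 = (m + r.+2))%N; last by lia.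
rewrite !add1n in S1 S2.
by split=> -[hm hr e]; split=> //; nia.
Qed.

Lemma neo_balcobalancer_inj (m r s : nat) :
  neo_balcobalancer m r -> neo_balcobalancer m s -> r = s.
Proof.
move=> /neo_balcobalancerE[hm hr er] /neo_balcobalancerE[_ hs es].
by case: (ltngtP r s) => // lt; nia.
Qed.

(** On positive entries both truncated subtractions are exact. *)
Definition neobc_step (p : nat * nat) : nat * nat :=
  ((29 * p.1 + 12 * p.2 - 6)%N, (12 * p.1 + 5 * p.2 - 4)%N).

Definition neobc_orbit (k : nat) : nat * nat := iter k neobc_step (6%N, 1%N).

Lemma neobc_orbit_balancer (k : nat) :
  neo_balcobalancer (neobc_orbit k).1 (neobc_orbit k).2.
Proof.
apply/neo_balcobalancerE; elim: k => [//|k].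
rewrite /neobc_orbit iterS; case: (iter k _ _) => m r /= [hm hr e].
rewrite (_ : 29 * m + 12 * r - 6 = 29 * m + 12 * r.-1 + 6)%N; last by lia.
rewrite (_ : 12 * m + 5 * r - 4 = 12 * m + 5 * r.-1 + 1)%N; last by lia.
by case: r hr e => // r _ /= e; split; nia.
Qed.

Lemma neobc_orbit_mono (k : nat) : ((neobc_orbit k).1 < (neobc_orbit k.+1).1)%N.
Proof.
have /neo_balcobalancerE := neobc_orbit_balancer k.
by rewrite /neobc_orbit iterS; case: (iter k _ _) => m r /= [hm hr _]; lia.
Qed.

(* The preimage of [(m, r)] under [neobc_step] is
   [(5m - 12r - 18, 29r - 12m + 44)]; the next two lemmas bound its entries. *)
Lemma neo_balcobalancer_pred_ge0 (m r : nat) : neo_balcobalancer m r ->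
  (12 * r + 18 <= 5 * m)%N.
Proof.
move=> /neo_balcobalancerE[hm hr e]; rewrite leqNgt; apply/negP => lt.
(* With s = r + 2, m = s + sqrt(2s^2 - 3s), and the bound becomes (s - 3)(s + 12) >= 0. *)
by nia.
Qed.

Lemma neo_balcobalancer_pred_gt0 (m r : nat) : neo_balcobalancer m r ->
  (12 * m < 29 * r + 44)%N.
Proof.
move=> h; have := neo_balcobalancer_pred_ge0 _ _ h.
move: h => /neo_balcobalancerE[hm hr e] ge; rewrite ltnNge; apply/negP => le.
(* The preimage is now (x, -u) with x, u >= 0, and [eq] below is the defining equation there. *)
pose x := (5 * m - (12 * r + 18))%N; pose u := (12 * m - (29 * r + 44))%N.
have em : (m + 12 * u + 6 = 29 * x)%N by lia.
have er : (r + 5 * u + 4 = 12 * x)%N by lia.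
have eq : (x * x + 2 + u + 2 * x * u = 4 * x + u * u)%N by nia.
have lb : (5 * u + 5 <= 12 * x)%N by lia.
case: u eq lb {le em er} => [|[|[|t]]] eq lb; [| nia | nia |].
  (* Here u = 0, and [eq] reads (x - 2)^2 = 2. *)
  have [x_small|x_large] := leqP x 3; last by nia.
  by move: x x_small eq {lb} => [|[|[|[|]]]].
(* With z = 12x and u = t + 3, [eq] says z(z + 24t + 24) = 144(t + 1)(t + 4), and [lb] says z >= 5(t
   + 4). This factor yields z(z + 24t + 24) >= 5(t + 4)(29t + 44), which is too large. *)
have := leq_mul lb (leqnn (12 * x + 29 * t + 44)%N); nia.
Qed.

Lemma neo_balcobalancer_orbit (m r : nat) :
  neo_balcobalancer m r -> exists k, (m, r) = neobc_orbit k.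
Proof.
elim/ltn_ind: m r => m IH r h.
have ge := neo_balcobalancer_pred_ge0 _ _ h.
have lt := neo_balcobalancer_pred_gt0 _ _ h.
move: h => /neo_balcobalancerE[hm hr e].
pose x := (5 * m - (12 * r + 18))%N; pose y := (29 * r + 44 - 12 * m)%N.
have em : (m + 6 = 29 * x + 12 * y)%N by lia.
have er : (r + 4 = 12 * x + 5 * y)%N by lia.
have y0 : (0 < y)%N by lia.
have eq : (x * x + y + 2 = (y + 2) * (2 * x + y))%N by nia.
clearbody x y.
(* The descent ends at (0, 1), which is excluded as a solution by [0 < m] and whose image is (6,
   1). *)
have [x0|x0] := posnP x.
  have y1 : y = 1%N by nia.
  by exists 0%N; rewrite /neobc_orbit /=; congr pair; lia.
have [k ek] : exists k, (x, y) = neobc_orbit k.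
  by apply: IH; [lia | apply/neo_balcobalancerE].
exists k.+1; rewrite /neobc_orbit iterS -/(neobc_orbit k) -ek /neobc_step /=.
by congr pair; lia.
Qed.

Lemma neo_balcobalancingP (m : nat) :
  neo_balcobalancing m <-> exists k, m = (neobc_orbit k).1.
Proof.
split=> [[r /neo_balcobalancer_orbit[k e]]|[k ->]].
  by exists k; rewrite -e.
by exists (neobc_orbit k).2; apply: neobc_orbit_balancer.
Qed.

(** The filtered interval and the list of f 0, ..., f k are both strictly sorted and have the same
    members, so they coincide. *)
Lemma count_increasing_range (P : pred nat) (f : nat -> nat) (k : nat) :
  {homo f : i j / (i < j)%N} -> (0 < f 0)%N ->
  (forall m, P m <-> exists i, m = f i) ->
  count P (iota 1 (f k)) = k.+1.
Proof.
move=> fmono f0 Pf; rewrite -size_filter.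
have le := leq_mono fmono.
suff -> : filter P (iota 1 (f k)) = map f (iota 0 k.+1).
  by rewrite size_map size_iota.
apply: (irr_sorted_eq ltn_trans ltnn).
- exact/(sorted_filter ltn_trans)/iota_ltn_sorted.
- by apply: (homo_sorted fmono); apply: iota_ltn_sorted.
move=> m; rewrite mem_filter mem_iota; apply/andP/mapP.
- case=> /Pf[i ->] /andP[_ lei]; exists i => //.
  by rewrite mem_iota /= add0n ltnS -le; lia.
- case=> i; rewrite mem_iota /= add0n ltnS => lei ->; split.
    by apply/Pf; exists i.
  by have := le 0%N i; have := le i k; lia.
Qed.

Lemma nth_neo_balcobalancingE (k m : nat) :
  nth_neo_balcobalancing k.+1 m <-> m = (neobc_orbit k).1.
Proof.
have cnt i : count (fun j => `[< neo_balcobalancing j >])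
    (iota 1 (neobc_orbit i).1) = i.+1.
  apply: (count_increasing_range _ (fun j => (neobc_orbit j).1)) => //.
  - by apply: homo_ltn; [apply: ltn_trans | apply: neobc_orbit_mono].
  - by move=> j; rewrite asboolE; apply: neo_balcobalancingP.
split=> [[/neo_balcobalancingP[i ->]]|->]; first by rewrite cnt => -[->].
by split; [apply/neo_balcobalancingP; exists k | apply: cnt].
Qed.

Lemma BneobcE (k : nat) : Bneobc k.+1 = (neobc_orbit k).1.
Proof.
apply: xget_unique => [|m]; first exact/nth_neo_balcobalancingE.
by move/nth_neo_balcobalancingE.
Qed.

Lemma RneobcE (k : nat) : Rneobc k.+1 = (neobc_orbit k).2.
Proof.
rewrite /Rneobc BneobcE; apply: xget_unique => [|r /= h].
  exact: neobc_orbit_balancer.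
exact: neo_balcobalancer_inj h (neobc_orbit_balancer k).
Qed.

(** The index [k.+1] corresponds to n = k + 2, as 4n - 5 is negative at n = 1. Four steps of the
    Pell-Lucas recurrence match one [neobc_step], linearly. *)
Lemma neobc_orbit_pell_lucas (k : nat) :
  (8 * (neobc_orbit k.+1).1
     = 36 * pell_lucas (4 * k).+4 + 15 * pell_lucas (4 * k).+3 + 6)%N /\
  (8 * (neobc_orbit k.+1).2 + 10
     = 15 * pell_lucas (4 * k).+4 + 6 * pell_lucas (4 * k).+3)%N.
Proof.
have rec j : pell_lucas j.+2 = (2 * pell_lucas j.+1 + pell_lucas j)%N by [].
elim: k => [//|k].
rewrite (_ : 4 * k.+1 = (4 * k).+4)%N; last by lia.
rewrite [neobc_orbit k.+2]iterS -/(neobc_orbit k.+1).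
case: (neobc_orbit k.+1) (4 * k)%N => m r j.
by rewrite /neobc_step /fst /snd !rec; lia.
Qed.

Theorem theorem5p2 (R : realType) (n : nat) (hn : (2 <= n)%N) :
  [/\ (Bneobc n)%:R =
        (36 * (pell_lucas (4 * n - 4))%:R
         + 15 * (pell_lucas (4 * n - 5))%:R + 6) / 8 :> R,
      Cneobc R n =
        (51 * (pell_lucas (4 * n - 4))%:R
         + 21 * (pell_lucas (4 * n - 5))%:R) / 4,
      (Rneobc n)%:R =
        (15 * (pell_lucas (4 * n - 4))%:R
         + 6 * (pell_lucas (4 * n - 5))%:R - 10) / 8 :> R &
      CRneobc R n =
        (21 * (pell_lucas (4 * n - 4))%:R
         + 9 * (pell_lucas (4 * n - 5))%:R) / 8].
Proof.
case: n hn => [|[|k]] // _; rewrite /Cneobc /CRneobc BneobcE RneobcE.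
rewrite (_ : 4 * k.+2 - 4 = (4 * k).+4)%N; last by lia.
rewrite (_ : 4 * k.+2 - 5 = (4 * k).+3)%N; last by lia.
have [eB eR] := neobc_orbit_pell_lucas k.
have /neo_balcobalancerE[_ _ e] := neobc_orbit_balancer k.+1.
move: (neobc_orbit k.+1) (pell_lucas _) (pell_lucas _) eB eR e.
case=> m r p q /= /(congr1 (GRing.natmul (1 : R))) eB.
move=> /(congr1 (GRing.natmul (1 : R))) eR /(congr1 (GRing.natmul (1 : R))) e.
rewrite !(natrD, natrM) in eB eR e.
have := ler0n R p; have := ler0n R q; have := ler0n R m; have := ler0n R r.
move: (m%:R : R) (r%:R : R) (p%:R : R) (q%:R : R) eB eR e => M S P Q.
move=> eB eR e S0 M0 Q0 P0; split; [lra | | lra |].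
- rewrite (_ : 8 * M ^+ 2 - 12 * M + 9 = (2 * M + 2 * S + 1) ^+ 2); last by lra.
  by rewrite sqrtr_sqr ger0_norm; lra.
(* The root [M - S - 2] is nonnegative because the closed forms make it the claimed value. *)
- rewrite (_ : 2 * S ^+ 2 + 5 * S + 2 = (M - S - 2) ^+ 2); last by lra.
  by rewrite sqrtr_sqr ger0_norm; lra.
Qed.
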